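(* Let $G$ be a finite simple connected graph of order $n \ge 2$. Let $\partial_2(G)$ denote the second smallest eigenvalue (counted with multiplicity) of the normalized distance Laplacian matrix $\mathcal{D}^{\mathcal{L}}(G)$, and let $t_{\max}(G)$ denote the maximum transmission in $G$. Then $$\partial_2(G) \ge \frac{2}{3} + \frac{4}{3\, t_{\max}(G)}.$$ Moreover, equality holds if and only if $G \cong K_{m,m}$ for some integer $m \ge 1$, where $K_{m,m}$ is the complete bipartite graph with both parts of size $m$.
   Context: Let $G = (V(G), E(G))$ be a finite simple connected graph of order $n = |V(G)| \ge 2$. For $u, v \in V(G)$, $\operatorname{dist}(u,v)$ denotes the graph distance between $u$ and $v$ in $G$ (so $\operatorname{dist}(u,u) = 0$ and $\operatorname{dist}(u,v) = 1$ if $u$ and $v$ are adjacent). The distance matrix $\mathcal{D}(G)$ is the $n \times n$ matrix indexed by $V(G)$ with entries $\mathcal{D}(G)_{u,v} := \operatorname{dist}(u,v)$. The transmission of a vertex $u$ is $t(u) := \sum_{v \in V(G)} \operatorname{dist}(u,v)$, which is positive for every $u$ since $G$ is connected and $n \ge 2$. The transmission matrix is the diagonal matrix $T(G) := \operatorname{diag}(t(u))_{u \in V(G)}$. The maximum transmission is $t_{\max}(G) := \max_{u \in V(G)} t(u)$. The normalized distance Laplacian matrix of $G$ is the real symmetric matrix $$\mathcal{D}^{\mathcal{L}}(G) := T(G)^{-1/2}\left(T(G) - \mathcal{D}(G)\right)T(G)^{-1/2},$$ whose (real) eigenvalues, listed with multiplicity in nondecreasing order, are $\partial_1(G) \le \partial_2(G)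 \le \cdots \le \partial_n(G)$. One has $\partial_1(G) = 0$ and $\partial_2(G) > 0$, so $\partial_2(G)$ is the smallest positive eigenvalue; it is called the spectral gap of $\mathcal{D}^{\mathcal{L}}(G)$. *)

(* Defs.v *)
From mathcomp Require Import all_boot all_order all_algebra.
From mathcomp Require Import reals polyrcf.

Set Implicit Arguments.
Unset Strict Implicit.
Unset Printing Implicit Defensive.

Import Order.TTheory GRing.Theory Num.Theory.
Local Open Scope ring_scope.

(* A finite simple graph is a symmetric irreflexive relation on a finType;
   these properties are hypotheses of the results, not of the definitions. *)

(* A shortest walk repeats no vertex, so only lengths below #|V| are searched;
   the value is the junk #|V| when no walk from u to v exists. *)
Definition gdist (V : finType) (e : rel V) (u v : V) : nat :=
  find (fun k => [exists p : k.-tuple V, path e u p && (last u p == v)])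
       (iota 0 #|V|).

Definition transmission (V : finType) (e : rel V) (u : V) : nat :=
  \sum_(v : V) gdist e u v.

Definition max_transmission (V : finType) (e : rel V) : nat :=
  \max_(u : V) transmission e u.

(* Matrices indexed by V are indexed by 'I_#|V| through enum_val. *)

Definition distance_mx (R : realType) (V : finType) (e : rel V) :
    'M[R]_#|V| :=
  \matrix_(i, j) (gdist e (enum_val i) (enum_val j))%:R.

Definition transmission_mx (R : realType) (V : finType) (e : rel V) :
    'M[R]_#|V| :=
  diag_mx (\row_i (transmission e (enum_val i))%:R).

Definition transmission_invsqrt_mx (R : realType) (V : finType) (e : rel V) :
    'M[R]_#|V| :=
  diag_mx (\row_i (Num.sqrt (transmission e (enum_val i))%:R)^-1).

Definition norm_dist_laplacian (R : realType) (V : finType) (e : rel V) :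
    'M[R]_#|V| :=
  transmission_invsqrt_mx R e *m (transmission_mx R e - distance_mx R e)
    *m transmission_invsqrt_mx R e.

(* The real eigenvalues in nondecreasing order, each repeated according to its
   algebraic multiplicity: rootsR lists the distinct real roots increasingly.
   For a symmetric A this list has size n. *)
Definition eigenvalues (R : realType) (n : nat) (A : 'M[R]_n) : seq R :=
  flatten [seq nseq (mup x (char_poly A)) x | x <- rootsR (char_poly A)].

(* Numbered from 1: the k-th smallest eigenvalue. *)
Definition ndl_eigenvalue (R : realType) (V : finType) (e : rel V) (k : nat) :
    R :=
  nth 0 (eigenvalues (norm_dist_laplacian R e)) k.-1.

Definition complete_bipartite (m n : nat) : rel ('I_m + 'I_n) :=
  fun u v =>
    match u, v with
    | inl _, inr _ | inr _, inl _ => true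
    | _, _ => false
    end.
Arguments complete_bipartite : clear implicits.

Definition graph_iso (V W : finType) (e : rel V) (e' : rel W) : Prop :=
  exists2 f : V -> W, bijective f & forall u v, e' (f u) (f v) = e u v.

(* Main.v *)
Require Import Defs.
From mathcomp Require Import all_boot all_order all_algebra.
From mathcomp Require Import reals polyrcf complex.
From mathcomp Require Import ring lra.

(** The bound is a statement about metrics. Let d be a metric on a finite set
    whose distances between distinct points are at least 1, let
    t u = \sum_v d u v, and let \sum_u f u = 0. Then
<<
      3 \sum_(u, v) d u v f u f v + 4 \sum_u f u ^ 2 <= \sum_u t u f u ^ 2,
>>
    which is [dist_form_le].

    To see this, let p and q be the positive and negative parts of f, and let
    s = \sum p = \sum q. Averaging the triangle inequality
    d u u' <= d u v + d v u' over the triples (u, u', v) with weights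
    p u p u' q v / s bounds \sum d p p by 2 \sum d p q. On the diagonal u = u'
    the left side is 0 and the right side at least 2, which improves the bound
    to 2 \sum d p q - 2 \sum p ^ 2. The same holds for q. The arithmetic-geometric
    mean inequality 2 |f u| |f v| <= f u ^ 2 + f v ^ 2, weighted by d, supplies
    the rest. The identity [rayleigh_defectE] packages all of this: it writes
    the difference of the two sides as a sum of nonnegative terms. Equality makes
    every term vanish, so |f| is constant, points of opposite sign are at
    distance 1 and points of equal sign at distance 2 ([dist_form_eq]). Since
    \sum f = 0, the two sign classes have the same size m, and for a graph
    distance this says that the graph is K_(m,m).

    The spectral side is the Courant-Fischer principle: the plane spanned by two
    eigenvectors for the two smallest eigenvalues meets every hyperplane, so the
    second eigenvalue bounds the Rayleigh quotient of some nonzero vector of the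
    hyperplane ([second_eigenvalue_rayleigh]). After the change of variables
    f = T^(-1/2) x, the hyperplane \sum f = 0 gives
    \sum t f ^ 2 - \sum d f f <= gap * \sum t f ^ 2, while the metric
    inequality and t <= t_max give
    \sum d f f <= (1 / 3 - 4 / (3 t_max)) \sum t f ^ 2. This is the bound, and
    equality in it forces equality in the metric inequality.

    Conversely, on K_(m,m) the constant function and the sign of the side are
    eigenvectors, for the eigenvalues 0 and 2 / 3 + 4 / (3 t_max), so the second
    eigenvalue is at most the latter. *)

Import Order.TTheory GRing.Theory Num.Theory.
Local Open Scope ring_scope.

Set Implicit Arguments.
Unset Strict Implicit.
Unset Printing Implicit Defensive.

(** * An inequality for finite metrics with distances at least 1 *)

Section MetricForm.
Variables (R : realFieldType) (V : finType) (d : V -> V -> R).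

Definition dist_form (x y : V -> R) : R := \sum_u \sum_v x u * y v * d u v.

(** The slack of the triangle inequality through v, minus the amount 2 which
    is always available on the diagonal: there the slack is 2 d u v. *)
Definition triangle_excess (u u' v : V) : R :=
  d u v + d u' v - d u u' - 2 * (u == u')%:R.

Definition excess_form (x y : V -> R) : R :=
  \sum_u \sum_u' \sum_v x u * x u' * y v * triangle_excess u u' v.

Lemma excess_formE (x y : V -> R) :
  excess_form x y = 2 * (\sum_u x u) * dist_form x y
    - (\sum_v y v) * (dist_form x x + 2 * \sum_u x u ^+ 2).
Proof.
have E1 : \sum_u \sum_u' \sum_v x u * x u' * y v * d u v
    = (\sum_u x u) * dist_form x y.
  rewrite mulr_sumr; apply: eq_bigr => u _; rewrite mulr_suml.
  apply: eq_bigr => u' _; rewrite mulr_sumr.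
  by apply: eq_bigr => v _; ring.
have E2 : \sum_u \sum_u' \sum_v x u * x u' * y v * d u' v
    = (\sum_u x u) * dist_form x y.
  rewrite mulr_suml; apply: eq_bigr => u _; rewrite mulr_sumr.
  apply: eq_bigr => u' _; rewrite mulr_sumr.
  by apply: eq_bigr => v _; ring.
have E3 : \sum_u \sum_u' \sum_v x u * x u' * y v * d u u'
    = (\sum_v y v) * dist_form x x.
  rewrite mulr_sumr; apply: eq_bigr => u _; rewrite mulr_sumr.
  apply: eq_bigr => u' _; rewrite mulr_suml.
  by apply: eq_bigr => v _; ring.
have E4 : \sum_u \sum_u' \sum_v x u * x u' * y v * (u == u')%:R
    = (\sum_v y v) * \sum_u x u ^+ 2.
  rewrite mulr_sumr; apply: eq_bigr => u _; rewrite (bigD1 u) //=.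
  rewrite [X in _ + X]big1 => [|u' ne].
    by rewrite addr0 mulr_suml; apply: eq_bigr => v _; rewrite eqxx mulr1; ring.
  by apply: big1 => v _; rewrite eq_sym (negPf ne) mulr0.
suff -> : excess_form x y =
    (\sum_u \sum_u' \sum_v x u * x u' * y v * d u v)
    + (\sum_u \sum_u' \sum_v x u * x u' * y v * d u' v)
    - (\sum_u \sum_u' \sum_v x u * x u' * y v * d u u')
    - 2 * (\sum_u \sum_u' \sum_v x u * x u' * y v * (u == u')%:R).
  by rewrite E1 E2 E3 E4; ring.
rewrite mulr_sumr -big_split -!sumrB; apply: eq_bigr => u _ /=.
rewrite mulr_sumr -big_split -!sumrB; apply: eq_bigr => u' _ /=.
rewrite mulr_sumr -big_split -!sumrB; apply: eq_bigr => v _ /=.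
by rewrite /triangle_excess; ring.
Qed.

Hypotheses (d_refl : forall u, d u u = 0) (d_sym : forall u v, d u v = d v u).
Hypothesis d_tri : forall u v w, d u w <= d u v + d v w.
Hypothesis d_ge1 : forall u v, u != v -> 1 <= d u v.

Lemma triangle_excess_ge0 u u' v :
  u != v -> u' != v -> 0 <= triangle_excess u u' v.
Proof.
move=> uv u'v; rewrite /triangle_excess; have [<-|_] := eqVneq u u'.
  by have := d_ge1 uv; rewrite d_refl mulr1; lra.
by have := d_tri u v u'; rewrite (d_sym v u') mulr0; lra.
Qed.

(** The factor x u x u' y v vanishes unless v differs from u and u', because
    x and y have disjoint supports. *)
Lemma excess_term_ge0 (x y : V -> R) :
  (forall u, 0 <= x u) -> (forall u, 0 <= y u) -> (forall u, x u * y u = 0) ->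
  forall u u' v, 0 <= x u * x u' * y v * triangle_excess u u' v.
Proof.
move=> x0 y0 xy u u' v.
have [->|uv] := eqVneq u v; first by rewrite [x v * _ * _]mulrAC xy !mul0r.
have [->|u'v] := eqVneq u' v; first by rewrite -[x u * _ * _]mulrA xy mulr0 mul0r.
by rewrite !mulr_ge0 // triangle_excess_ge0.
Qed.

Lemma excess_form_ge0 (x y : V -> R) :
  (forall u, 0 <= x u) -> (forall u, 0 <= y u) -> (forall u, x u * y u = 0) ->
  0 <= excess_form x y.
Proof.
by move=> x0 y0 xy; do 3![apply: sumr_ge0 => ? _]; apply: excess_term_ge0.
Qed.

Lemma excess_form_eq0 (x y : V -> R) :
  (forall u, 0 <= x u) -> (forall u, 0 <= y u) -> (forall u, x u * y u = 0) ->
  excess_form x y = 0 ->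
  forall u u' v, x u != 0 -> x u' != 0 -> y v != 0 -> triangle_excess u u' v = 0.
Proof.
move=> x0 y0 xy; have t0 := excess_term_ge0 x0 y0 xy.
move=> /psumr_eq0P E u u' v xu xu' yv.
have {}E : \sum_u' \sum_v x u * x u' * y v * triangle_excess u u' v = 0.
  by apply: E => // w _; do 2![apply: sumr_ge0 => ? _].
move/psumr_eq0P: E => E.
have {}E : \sum_v x u * x u' * y v * triangle_excess u u' v = 0.
  by apply: E => // w _; apply: sumr_ge0.
move/psumr_eq0P: E => /(_ (fun v _ => t0 u u' v) v isT) /eqP.
by rewrite !mulf_eq0 (negPf xu) (negPf xu') (negPf yv) /= => /eqP.
Qed.

Lemma dist_formDl x x' y :
  dist_form (fun u => x u + x' u) y = dist_form x y + dist_form x' y.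
Proof.
rewrite -big_split; apply: eq_bigr => u _; rewrite -big_split.
by apply: eq_bigr => v _ /=; ring.
Qed.

Lemma dist_formNl x y : dist_form (fun u => - x u) y = - dist_form x y.
Proof.
rewrite -sumrN; apply: eq_bigr => u _; rewrite -sumrN.
by apply: eq_bigr => v _ /=; ring.
Qed.

Lemma dist_formC x y : dist_form x y = dist_form y x.
Proof.
rewrite /dist_form exchange_big; apply: eq_bigr => u _; apply: eq_bigr => v _.
by rewrite d_sym; ring.
Qed.

Lemma eq_dist_form x x' y y' : x =1 x' -> y =1 y' ->
  dist_form x y = dist_form x' y'.
Proof.
by move=> ex ey; apply: eq_bigr => u _; apply: eq_bigr => v _; rewrite ex ey.
Qed.

(** The arithmetic-geometric mean defect of g, weighted by d. *)
Lemma spread_sumE g : \sum_u \sum_v d u v * (g u - g v) ^+ 2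
  = 2 * (\sum_u (\sum_v d u v) * g u ^+ 2) - 2 * dist_form g g.
Proof.
have -> : 2 * (\sum_u (\sum_v d u v) * g u ^+ 2) =
    \sum_u \sum_v d u v * g u ^+ 2 + \sum_u \sum_v d u v * g v ^+ 2.
  rewrite [X in _ = _ + X]exchange_big -big_split mulr_sumr /=.
  apply: eq_bigr => u _; rewrite mulr_suml mulr_sumr -big_split.
  by apply: eq_bigr => v _ /=; rewrite (d_sym v u); ring.
rewrite mulr_sumr -big_split -sumrB; apply: eq_bigr => u _ /=.
rewrite mulr_sumr -big_split -sumrB; apply: eq_bigr => v _ /=.
by ring.
Qed.

Definition pos_part (f : V -> R) u := (`|f u| + f u) / 2.
Definition neg_part (f : V -> R) u := (`|f u| - f u) / 2.

Lemma pos_part_ge0 f u : 0 <= pos_part f u.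
Proof. by rewrite /pos_part; have := ler_norm (- f u); rewrite normrN; lra. Qed.

Lemma neg_part_ge0 f u : 0 <= neg_part f u.
Proof. by rewrite /neg_part; have := ler_norm (f u); lra. Qed.

Lemma pos_neg_part0 f u : pos_part f u * neg_part f u = 0.
Proof.
have -> : pos_part f u * neg_part f u = (`|f u| ^+ 2 - f u ^+ 2) / 4.
  by rewrite /pos_part /neg_part; field.
by rewrite real_normK ?num_real // subrr mul0r.
Qed.

(** Multiplying by the common mass s of the two parts of f clears the
    denominators of the averaging weights p u p u' q v / s. With X the sum of
    the forms of the two parts, B their mixed form and F = \sum f ^ 2, the form
    of f is X - 2 B and that of |f| is X + 2 B. The inequality
    3 (X - 2 B) + 4 F <= X + 2 B is twice X <= 4 B - 2 F, which is the sum of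
    the averaged triangle inequalities of the two parts. *)
Lemma rayleigh_defectE f (f0 : \sum_u f u = 0) :
  (\sum_u pos_part f u) * ((\sum_u (\sum_v d u v) * f u ^+ 2)
     - 3 * dist_form f f - 4 * \sum_u f u ^+ 2)
  = (\sum_u pos_part f u)
      * ((\sum_u \sum_v d u v * (`|f u| - `|f v|) ^+ 2) / 2)
    + 2 * (excess_form (pos_part f) (neg_part f)
           + excess_form (neg_part f) (pos_part f)).
Proof.
set p := pos_part f; set q := neg_part f.
have Es : \sum_u q u = \sum_u p u.
  apply/eqP; rewrite eq_sym -subr_eq0 -sumrB -[X in _ == X]f0; apply/eqP.
  by apply: eq_bigr => u _; rewrite /p /q /pos_part /neg_part; field.
have E2 : \sum_u f u ^+ 2 = \sum_u p u ^+ 2 + \sum_u q u ^+ 2.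
  rewrite -big_split; apply: eq_bigr => u _ /=.
  transitivity ((p u - q u) ^+ 2 + 2 * (p u * q u)); last by ring.
  by rewrite pos_neg_part0 /p /q /pos_part /neg_part; field.
have Ef : dist_form f f = dist_form p p + dist_form q q - 2 * dist_form p q.
  rewrite (@eq_dist_form _ (fun u => p u + (- q u)) _ f _ (frefl _)); last first.
    by move=> u; rewrite /p /q /pos_part /neg_part; field.
  rewrite dist_formDl dist_formNl (dist_formC p) (dist_formC q).
  rewrite (@eq_dist_form f (fun u => p u + (- q u)) p p _ (frefl _)); last first.
    by move=> u; rewrite /p /q /pos_part /neg_part; field.
  rewrite (@eq_dist_form f (fun u => p u + (- q u)) q q _ (frefl _)); last first.
    by move=> u; rewrite /p /q /pos_part /neg_part; field.
  by rewrite !dist_formDl !dist_formNl (dist_formC q p); ring.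
set g := fun u => `|f u|.
have Eg : dist_form g g = dist_form p p + dist_form q q + 2 * dist_form p q.
  have gE : g =1 (fun u => p u + q u).
    by move=> u; rewrite /g /p /q /pos_part /neg_part; field.
  rewrite (eq_dist_form gE gE) dist_formDl (dist_formC p) (dist_formC q).
  by rewrite !dist_formDl (dist_formC q p); ring.
have -> := spread_sumE g.
have -> : \sum_u (\sum_v d u v) * g u ^+ 2 = \sum_u (\sum_v d u v) * f u ^+ 2.
  by apply: eq_bigr => u _; rewrite /g real_normK ?num_real.
by rewrite !excess_formE Es Ef Eg E2 (dist_formC q p); field.
Qed.

Lemma sum_pos_part_gt0 f u0 : \sum_u f u = 0 -> f u0 != 0 ->
  0 < \sum_u pos_part f u.
Proof.
move=> f0 fu0; have -> : \sum_u pos_part f u = (\sum_u `|f u|) / 2.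
  transitivity ((\sum_u `|f u| + \sum_u f u) / 2); last by rewrite f0 addr0.
  by rewrite -big_split mulr_suml; apply: eq_bigr.
rewrite divr_gt0 // lt_neqAle sumr_ge0 // andbT eq_sym psumr_neq0 //.
by apply/hasP; exists u0; rewrite ?mem_index_enum // normr_gt0.
Qed.

Lemma spread_sum_ge0 (f : V -> R) : 0 <= \sum_u \sum_v d u v * (`|f u| - `|f v|) ^+ 2.
Proof.
apply: sumr_ge0 => u _; apply: sumr_ge0 => v _; rewrite mulr_ge0 ?sqr_ge0 //.
by have := d_tri u v u; rewrite d_refl (d_sym v u); lra.
Qed.

Lemma dist_form_le f : \sum_u f u = 0 ->
  3 * dist_form f f + 4 * \sum_u f u ^+ 2 <= \sum_u (\sum_v d u v) * f u ^+ 2.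
Proof.
move=> f0; have [/existsP[u0 fu0]|/existsPn f00] := boolP [exists u, f u != 0].
  have s_gt0 := sum_pos_part_gt0 f0 fu0.
  rewrite -subr_ge0 opprD addrA -(pmulr_rge0 _ s_gt0) rayleigh_defectE //.
  have s1 := excess_form_ge0 (pos_part_ge0 f) (neg_part_ge0 f) (pos_neg_part0 f).
  have s2 : 0 <= excess_form (neg_part f) (pos_part f).
    apply: excess_form_ge0; [exact: neg_part_ge0|exact: pos_part_ge0|].
    by move=> u; rewrite mulrC pos_neg_part0.
  have := mulr_ge0 (ltW s_gt0) (divr_ge0 (spread_sum_ge0 f) (ler0n R 2)).
  by lra.
have {}f00 u : f u = 0 by apply/eqP; rewrite -[_ == _]negbK f00.
rewrite /dist_form !big1 ?mulr0 ?addr0 // => u _; rewrite ?f00 ?expr0n ?mulr0 //.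
by apply: big1 => v _; rewrite f00 !mul0r.
Qed.

(** Equality kills each nonnegative term of [rayleigh_defectE]. Both sign
    classes are then nonempty, so each pair of points of the same sign has a
    point of the other sign to be compared with. *)
Lemma dist_form_eq f : \sum_u f u = 0 -> (exists u, f u != 0) ->
  3 * dist_form f f + 4 * \sum_u f u ^+ 2 = \sum_u (\sum_v d u v) * f u ^+ 2 ->
  [/\ forall u v, `|f u| = `|f v|,
      forall u v, 0 < f u -> f v < 0 -> d u v = 1
    & forall u v, u != v -> 0 < f u * f v -> d u v = 2].
Proof.
move=> f0 [u0 fu0] E; have s_gt0 := sum_pos_part_gt0 f0 fu0.
have := rayleigh_defectE f0; rewrite -E -addrA -opprD subrr mulr0.
have npE u : neg_part f u * pos_part f u = 0 by rewrite mulrC pos_neg_part0.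
have s1 := excess_form_ge0 (pos_part_ge0 f) (neg_part_ge0 f) (pos_neg_part0 f).
have s2 := excess_form_ge0 (neg_part_ge0 f) (pos_part_ge0 f) npE.
have s3 := mulr_ge0 (ltW s_gt0) (divr_ge0 (spread_sum_ge0 f) (ler0n R 2)).
move=> Z; have Z1 : excess_form (pos_part f) (neg_part f) = 0 by lra.
have Z2 : excess_form (neg_part f) (pos_part f) = 0 by lra.
have {s3 Z} /eqP Z3 : (\sum_u pos_part f u)
  * ((\sum_u \sum_v d u v * (`|f u| - `|f v|) ^+ 2) / 2) = 0 by lra.
move/excess_form_eq0: Z1.
move=> /(_ (pos_part_ge0 f) (neg_part_ge0 f) (pos_neg_part0 f)) X1.
move/excess_form_eq0: Z2 => /(_ (neg_part_ge0 f) (pos_part_ge0 f) npE) X2.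
have d0 u v : 0 <= d u v.
  by have := d_tri u v u; rewrite d_refl (d_sym v u); lra.
have nE u v : `|f u| = `|f v|.
  have [->//|uv] := eqVneq u v.
  move: Z3; rewrite !mulf_eq0 invr_eq0 pnatr_eq0 (gt_eqF s_gt0) orbF /= => /eqP Z.
  have {}Z : \sum_v d u v * (`|f u| - `|f v|) ^+ 2 = 0.
    move/psumr_eq0P: Z => -> // w _; apply: sumr_ge0 => w' _.
    by rewrite mulr_ge0 // sqr_ge0.
  move/psumr_eq0P: Z => /(_ (fun v _ => mulr_ge0 (d0 u v) (sqr_ge0 _)) v isT) /eqP.
  rewrite mulf_eq0 sqrf_eq0 subr_eq0 gt_eqF /= => [/eqP //|].
  by have := d_ge1 uv; lra.
have pN0 u : 0 < f u -> pos_part f u != 0.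
  by move=> fu; rewrite /pos_part gtr0_norm // gt_eqF //; lra.
have nN0 u : f u < 0 -> neg_part f u != 0.
  by move=> fu; rewrite /neg_part ltr0_norm // gt_eqF //; lra.
(* The triples (u, u, v) have excess 2 d u v - 2. *)
have cross u v : 0 < f u -> f v < 0 -> d u v = 1.
  move=> fu fv; have := X1 u u v (pN0 _ fu) (pN0 _ fu) (nN0 _ fv).
  by rewrite /triangle_excess d_refl eqxx mulr1; lra.
have fN0 u : f u != 0 by rewrite -normr_eq0 (nE u u0) normr_eq0.
have [a fa] : exists a, 0 < f a.
  apply/existsP/existsPn => /= Hn; move: s_gt0; rewrite big1 ?ltxx // => u _.
  by rewrite /pos_part ler0_norm ?leNgt ?Hn //; field.
have [b fb] : exists b, f b < 0.
  apply/existsP/existsPn => /= Hn.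
  move/psumr_eq0P: f0 => f0; move/eqP: (fN0 a); apply; apply: f0 => // u _.
  by rewrite leNgt Hn.
split => // u v uv fuv.
have [fu|fu|fu] := ltrgt0P (f u).
- have fv : 0 < f v by rewrite -(pmulr_rgt0 _ fu).
  have := X1 u v b (pN0 _ fu) (pN0 _ fv) (nN0 _ fb).
  by rewrite /triangle_excess (negPf uv) mulr0 !(cross _ b) //; lra.
- have fv : f v < 0 by rewrite -(nmulr_rgt0 _ fu).
  have := X2 u v a (nN0 _ fu) (nN0 _ fv) (pN0 _ fa).
  by rewrite /triangle_excess (negPf uv) mulr0 !(d_sym _ a) !(cross a) //; lra.
- by have := fN0 u; rewrite fu eqxx.
Qed.

End MetricForm.

(** * Eigenvalues of real symmetric matrices *)

Lemma perm_eigenvalues (R : realType) n (A : 'M[R]_n) (s : seq R) :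
  char_poly A = \prod_(x <- s) ('X - x%:P) -> perm_eq (eigenvalues A) s.
Proof.
move=> As; rewrite /eigenvalues As; set p := \prod_(x <- s) _.
have p0 : p != 0 by rewrite monic_neq0 // monic_prod_XsubC.
apply: perm_trans (perm_count_undup s).
under eq_map => x do rewrite /p mu_prod_XsubC.
apply/perm_flatten/perm_map/uniq_perm; rewrite ?undup_uniq ?uniq_roots // => x.
by have := roots_on_rootsR p0 x; rewrite inE /= root_prod_XsubC mem_undup => <-.
Qed.

Lemma sorted_eigenvalues (R : realType) n (A : 'M[R]_n) :
  sorted <=%R (eigenvalues A).
Proof.
rewrite /eigenvalues; set p := char_poly A.
have : sorted <%R (rootsR p) by exact: sorted_roots.
elim: (rootsR p) => //= a r IH.
rewrite (path_sortedE lt_trans) => /andP[/allP lt_ar /IH {}IH].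
elim: (mup a p) => //= k IHk.
rewrite (path_sortedE le_trans) IHk andbT; apply/allP => x.
rewrite mem_cat mem_nseq => /orP[/andP[_ /eqP-> //]|].
case/flattenP => _ /mapP[b br ->]; rewrite mem_nseq => /andP[_ /eqP->].
exact/ltW/lt_ar.
Qed.

Lemma mem_eigenvalues (R : realType) n (A : 'M[R]_n) (x : R) :
  eigenvalue A x -> x \in eigenvalues A.
Proof.
rewrite eigenvalue_root_char => Ax.
have p0 : char_poly A != 0 by rewrite monic_neq0 // char_poly_monic.
apply/flatten_mapP; exists x; last first.
  by rewrite mem_nseq eqxx andbT -XsubC_dvd // dvdp_XsubCl.
by have := roots_on_rootsR p0 x; rewrite inE /= Ax => <-.
Qed.

(** If the second entry exceeded x, so would every later entry, and at most
    the first could be counted. *)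
Lemma nth1_le_of_count (R : realDomainType) (s : seq R) (x : R) :
  sorted <=%R s -> (1 < count (<= x) s)%N -> nth 0 s 1 <= x.
Proof.
case: s => [|a [|b s]] //=; first by case: (_ <= _).
move=> /andP[ab bs]; case: (leP b x) => // xb.
rewrite [count _ s](_ : _ = 0)%N; first by case: (_ <= _).
apply/eqP; rewrite -leqn0 leqNgt -has_count; apply/hasPn => y ys.
rewrite -ltNge; apply: lt_le_trans xb _.
by have /allP/(_ y ys) := order_path_min le_trans bs.
Qed.

Lemma count_le_nth1 (R : realDomainType) (s : seq R) :
  sorted <=%R s -> (1 < size s)%N -> (1 < count (<= nth 0%R s 1) s)%N.
Proof. by case: s => [|a [|b s]] //= /andP[-> _] _; rewrite lexx. Qed.

Lemma char_poly_similar (F : fieldType) n (P A : 'M[F]_n) : P \in unitmx ->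
  char_poly (invmx P *m A *m P) = char_poly A.
Proof.
move=> Pu; rewrite /char_poly /char_poly_mx !map_mxM /=.
set Q := map_mx polyC P; set Q' := map_mx polyC (invmx P).
have QQ : Q' *m Q = 1%:M by rewrite -map_mxM mulVmx // map_mx1.
rewrite [in LHS](_ : 'X%:M = Q' *m 'X%:M *m Q); last first.
  by rewrite scalar_mxC -mulmxA QQ mulmx1.
rewrite -mulmxBl -mulmxBr !det_mulmx mulrC mulrA -det_mulmx.
by rewrite (mulmx1C QQ) det1 mul1r.
Qed.

Section Spectrum.
Variable R : realType.
Local Notation C := R[i].
Local Notation toC := (real_complex R).
Local Open Scope sesquilinear_scope.

(** Obtained from the spectral theorem for Hermitian matrices over the complex
    field; the eigenvectors, the rows of P, may therefore be complex. *)
Lemma real_symmetric_spectral n (A : 'M[R]_n) : A^T = A ->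
  exists (P : 'M[C]_n) (d : 'I_n -> R),
    [/\ P \is unitarymx,
        map_mx toC A = P^t* *m diag_mx (\row_i toC (d i)) *m P
      & char_poly A = \prod_i ('X - (d i)%:P)].
Proof.
move=> AT; set Ac := map_mx toC A.
have Ah : Ac \is hermsymmx.
  apply/is_hermitianmxP; rewrite expr0 scale1r /Ac -{1}AT.
  by apply/matrixP => i j; rewrite !mxE; exact/esym/conjc_real.
have dr := hermitian_spectral_diag_real Ah.
have An := hermitian_normalmx Ah.
have /orthomx_spectralP AE := An.
have Pu := spectral_unitarymx Ac.
move: AE Pu dr; set P := spectralmx Ac; set D := spectral_diag Ac => AE Pu dr.
have DE : D = \row_i toC (complex.Re (D 0 i)).
  by apply/rowP => i; rewrite mxE; apply/esym/RRe_real/mxOverP.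
exists P, (fun i => complex.Re (D 0 i)); split => //.
  by rewrite -DE -invmx_unitary.
apply: (map_poly_inj toC); rewrite map_char_poly -/Ac AE.
rewrite char_poly_similar ?unitarymx_unit // char_poly_trig ?diag_mx_is_trig //.
rewrite rmorph_prod; apply: eq_bigr => i _.
by rewrite /= map_polyXsubC mxE eqxx mulr1n {1}DE mxE.
Qed.

Lemma Re_sum (I : finType) (F : I -> C) :
  complex.Re (\sum_i F i) = \sum_i complex.Re (F i).
Proof. by apply: (big_morph (@complex.Re R)) => // -[? ?] [? ?]. Qed.

Lemma Im_sum (I : finType) (F : I -> C) :
  complex.Im (\sum_i F i) = \sum_i complex.Im (F i).
Proof. by apply: (big_morph (@complex.Im R)) => // -[? ?] [? ?]. Qed.

(** The easy half of the Courant-Fischer principle. Two of the eigenvectors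
    have an eigenvalue at most the second one, and some nonzero y in their
    span satisfies the linear condition. Since A and h are real, the condition
    splits, and the Rayleigh inequality adds up, over the real and imaginary
    parts of y: one of them is the wanted vector. *)
Lemma second_eigenvalue_rayleigh n (A : 'M[R]_n) (h : 'I_n -> R) :
  A^T = A -> (1 < n)%N ->
  exists f : 'I_n -> R,
    [/\ exists i, f i != 0, \sum_i f i * h i = 0
      & \sum_i \sum_j f i * f j * A i j
          <= nth 0 (eigenvalues A) 1 * \sum_i f i ^+ 2].
Proof.
move=> AT n_gt1; have [P [d [Pu AE charA]]] := real_symmetric_spectral AT.
set m := nth 0 _ 1.
have [i [j [ij di dj]]] : exists i j, [/\ i != j, d i <= m & d j <= m].
  have pd : perm_eq (eigenvalues A) [seq d i | i <- enum 'I_n].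
    apply: perm_eigenvalues.
    by rewrite charA big_map big_enum.
  have: (1 < count (<= m) [seq d i | i <- enum 'I_n])%N.
    rewrite -(permP pd); apply: count_le_nth1 (sorted_eigenvalues A) _.
    by rewrite (perm_size pd) size_map size_enum_ord.
  rewrite count_map -sum1_count big_enum_cond sum1_card.
  by case/card_gt1P => i [j [Hi Hj ij]]; exists i, j.
have [w wE] : exists w, w = P *m \col_k toC (h k) by exists (P *m \col_k toC (h k)).
(* Coordinates of y in the eigenbasis: the values of the linear condition on
   the two eigenvectors, exchanged and with one sign changed. *)
have [z [z0 zw zsupp]] : exists z : 'rV[C]_n,
    [/\ z != 0, z *m w = 0 & forall k, z 0 k != 0 -> d k <= m].
  have [wi0|wi0] := eqVneq (w i 0) 0.
    exists (delta_mx 0 i); split.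
    - apply/eqP => /rowP/(_ i); rewrite !mxE !eqxx => /eqP.
      by rewrite oner_eq0.
    - by rewrite -rowE; apply/rowP => k; rewrite mxE ord1 wi0 mxE.
    - by move=> k; rewrite mxE eqxx /=; case: (eqVneq k i) => [-> //|_]; rewrite eqxx.
  exists (w j 0 *: delta_mx 0 i - w i 0 *: delta_mx 0 j); split.
  - apply/eqP => /rowP/(_ j); rewrite !mxE !eqxx (eq_sym j) (negPf ij) /=.
    by rewrite mulr0 mulr1 sub0r => /eqP; rewrite oppr_eq0 (negPf wi0).
  - rewrite mulmxBl -!scalemxAl -!rowE; apply/rowP => k.
    by rewrite !mxE ord1; ring.
  - move=> k; rewrite !mxE eqxx /=; case: (eqVneq k i) => [-> //|_].
    by case: (eqVneq k j) => [-> //|_]; rewrite !mulr0 subrr eqxx.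
have [y yP] : exists y, y = z *m P by exists (z *m P).
pose a k := complex.Re (y 0 k); pose b k := complex.Im (y 0 k).
have yE k : y 0 k = (a k +i* b k)%C by rewrite /a /b; case: (y 0 k).
have yh : \sum_k y 0 k * toC (h k) = 0.
  transitivity ((y *m \col_k toC (h k)) 0 0).
    by rewrite mxE; apply: eq_bigr => k _; rewrite mxE.
  by rewrite yP -mulmxA -wE zw mxE.
have ah : \sum_k a k * h k = 0.
  transitivity (complex.Re (\sum_k y 0 k * toC (h k))); last by rewrite yh.
  rewrite Re_sum.
  by apply: eq_bigr => k _; rewrite yE /= mulr0 subr0.
have bh : \sum_k b k * h k = 0.
  transitivity (complex.Im (\sum_k y 0 k * toC (h k))); last by rewrite yh.
  rewrite Im_sum.
  by apply: eq_bigr => k _; rewrite yE /= mulr0 add0r.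
have y0 : y != 0.
  apply: contraNneq z0 => y0.
  by rewrite -(mulmxtVK z Pu) -yP y0 mul0mx.
have yy : \sum_k (a k ^+ 2 + b k ^+ 2) = complex.Re (\sum_k z 0 k * (z 0 k)^*).
  transitivity (complex.Re ((y *m y^t* ) 0 0)).
    rewrite mxE Re_sum; apply: eq_bigr => k _; rewrite !mxE yE /=.
    by ring.
  rewrite yP trmx_mul map_mxM mulmxA mulmxtVK // mxE.
  by congr complex.Re; apply: eq_bigr => k _; rewrite !mxE.
have yAy : \sum_k \sum_l (a k * a l * A k l + b k * b l * A k l)
    = complex.Re (\sum_k toC (d k) * (z 0 k * (z 0 k)^* )).
  transitivity (complex.Re ((y *m map_mx toC A *m y^t* ) 0 0)).
    rewrite mxE Re_sum exchange_big; apply: eq_bigr => l _ /=.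
    rewrite [X in X * _]mxE mulr_suml Re_sum; apply: eq_bigr => k _.
    by rewrite !mxE !yE /=; ring.
  rewrite AE yP trmx_mul map_mxM !mulmxA mulmxtVK // -!mulmxA (mulmxA P).
  rewrite (unitarymxP Pu) mul1mx mulmxA mxE; congr complex.Re.
  by apply: eq_bigr => k _; rewrite mul_mx_diag !mxE; ring.
have {yy yAy} le_m : \sum_k \sum_l (a k * a l * A k l + b k * b l * A k l)
    <= m * \sum_k (a k ^+ 2 + b k ^+ 2).
  rewrite yAy yy !Re_sum mulr_sumr; apply: ler_sum => k _.
  have [->|zk] := eqVneq (z 0 k) 0; first by rewrite !mul0r !mulr0.
  have := zsupp k zk; case: (z 0 k) => u v /= dk.
  have : 0 <= (m - d k) * (u ^+ 2 + v ^+ 2).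
    by rewrite mulr_ge0 ?subr_ge0 // addr_ge0 ?sqr_ge0.
  by lra.
have {le_m} le_m : (\sum_k \sum_l a k * a l * A k l - m * \sum_k a k ^+ 2)
    + (\sum_k \sum_l b k * b l * A k l - m * \sum_k b k ^+ 2) <= 0.
  move: le_m; under eq_bigr => k _ do rewrite big_split.
  by rewrite !big_split /=; lra.
have zero_case (c c' : 'I_n -> R) : (forall k, c k = 0) ->
    (\sum_k \sum_l c k * c l * A k l - m * \sum_k c k ^+ 2)
    + (\sum_k \sum_l c' k * c' l * A k l - m * \sum_k c' k ^+ 2) <= 0 ->
    \sum_k \sum_l c' k * c' l * A k l <= m * \sum_k c' k ^+ 2.
  move=> c0; rewrite [X in X - _]big1 ?[X in m * X]big1; first by lra.
    by move=> k _; rewrite c0 expr0n.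
  by move=> k _; rewrite big1 // => l _; rewrite c0 !mul0r.
have [/existsP ea|/existsPn ea] := boolP [exists k, a k != 0]; last first.
  have {}ea k : a k = 0 by apply/eqP; rewrite -[_ == _]negbK ea.
  exists b; split => //; last exact: zero_case ea le_m.
  apply/existsP; apply: contraNT y0 => /existsPn eb.
  apply/eqP/rowP => k; rewrite mxE yE ea.
  by move: (eb k); rewrite negbK => /eqP->.
have [/existsP eb|/existsPn eb] := boolP [exists k, b k != 0]; last first.
  have {}eb k : b k = 0 by apply/eqP; rewrite -[_ == _]negbK eb.
  by exists a; split => //; apply: zero_case eb _; rewrite addrC.
have [le_a|gt_a] := lerP (\sum_k \sum_l a k * a l * A k l) (m * \sum_k a k ^+ 2).
  by exists a.
by exists b; split => //; lra.
Qed.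

End Spectrum.

(** * The graph distance *)

Section GraphDistance.
Variables (V : finType) (e : rel V).
Hypotheses (e_sym : symmetric e) (e_irr : irreflexive e).
Hypothesis e_conn : forall u v : V, connect e u v.

Lemma gdist_le_path u p : path e u p -> (gdist e u (last u p) <= size p)%N.
Proof.
move=> up; rewrite /gdist; have [Vp|pV] := leqP #|V| (size p).
  by apply: leq_trans (find_size _ _) _; rewrite size_iota.
rewrite leqNgt; apply/negP => /(before_find 0%N).
rewrite nth_iota // add0n => /existsP; apply.
by exists (in_tuple p); rewrite up eqxx.
Qed.

(** Shortening a walk to a path without repeated vertices brings its length
    below #|V|, within the range searched by [gdist]. *)
Lemma gdist_geodesic u v :
  exists p, [/\ path e u p, last u p = v & size p = gdist e u v].
Proof.
rewrite /gdist; set a := (X in find X _).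
have ha : has a (iota 0 #|V|).
  have /connectP[p up vp] := e_conn u v.
  case/shortenP: up vp => q uq /card_uniqP q_uniq _ vq.
  apply/hasP; exists (size q); last first.
    by apply/existsP; exists (in_tuple q); rewrite uq vq eqxx.
  rewrite mem_iota /= add0n -[(size q < _)%N]/(size (u :: q) <= _)%N.
  by rewrite -q_uniq max_card.
have := nth_find 0%N ha; rewrite nth_iota; last first.
  by move: ha; rewrite has_find size_iota.
by rewrite add0n => /existsP[p /andP[up /eqP pv]]; exists p; rewrite size_tuple.
Qed.

Lemma gdistxx u : gdist e u u = 0%N.
Proof. by apply/eqP; rewrite -leqn0; apply: (@gdist_le_path u [::]). Qed.

Lemma gdist_gt0 u v : u != v -> (0 < gdist e u v)%N.
Proof.
move=> uv; have [p [_ pv <-]] := gdist_geodesic u v.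
by case: p pv => //= uv'; rewrite uv' eqxx in uv.
Qed.

Lemma gdist_triangle u v w : (gdist e u w <= gdist e u v + gdist e v w)%N.
Proof.
have [p [up pv <-]] := gdist_geodesic u v.
have [q [vq qw <-]] := gdist_geodesic v w.
rewrite -size_cat -[w]qw -{1}pv -last_cat.
by apply: gdist_le_path; rewrite cat_path up pv.
Qed.

Lemma gdist_sym u v : gdist e u v = gdist e v u.
Proof.
suff le_sym x y : (gdist e x y <= gdist e y x)%N.
  by apply/eqP; rewrite eqn_leq !le_sym.
have [p [yp px <-]] := gdist_geodesic y x.
have xq : path e x (rev (belast y p)).
  by rewrite -px rev_path (eq_path (e' := e)) // => a b; rewrite e_sym.
have := gdist_le_path xq; rewrite size_rev size_belast.
by case: p {yp xq} px => [/= ->|z p _] //=; rewrite rev_cons last_rcons.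
Qed.

Lemma gdist_eq1 u v : (gdist e u v == 1%N) = e u v.
Proof.
apply/eqP/idP => [d1|uv].
  have [[|w [|? ?]] [/= + + sz]] := gdist_geodesic u v; rewrite d1 in sz => //.
  by rewrite andbT => + <-.
apply/eqP; rewrite eqn_leq gdist_gt0; last first.
  by apply: contraTneq uv => ->; rewrite e_irr.
by rewrite andbT; apply: (@gdist_le_path u [:: v]); rewrite /= uv.
Qed.

End GraphDistance.

(** * The spectral gap of the normalized distance Laplacian *)

Section DistanceLaplacian.
Variables (R : realType) (V : finType) (e : rel V).
Hypotheses (e_sym : symmetric e) (e_irr : irreflexive e).
Hypothesis e_conn : forall u v : V, connect e u v.
Hypothesis V_ge2 : (2 <= #|V|)%N.

Let d (u v : V) : R := (gdist e u v)%:R.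
Let t (u : V) : R := (transmission e u)%:R.

Lemma sum_gdistE u : \sum_v d u v = t u.
Proof. by rewrite /t /transmission natr_sum. Qed.

Lemma transmission_gt0 u : 0 < t u.
Proof.
have /card_gt1P[a [b [_ _ ab]]] := V_ge2.
have [v uv] : exists v, u != v.
  have [ua|] := eqVneq u a; last by exists a.
  by exists b; rewrite ua.
rewrite ltr0n /transmission (bigD1 v) //= addn_gt0.
by rewrite (gdist_gt0 e_conn).
Qed.

Lemma norm_dist_laplacianE i j : norm_dist_laplacian R e i j
  = (Num.sqrt (t (enum_val i)))^-1 * (Num.sqrt (t (enum_val j)))^-1
    * (t (enum_val i) *+ (i == j) - d (enum_val i) (enum_val j)).
Proof.
rewrite /norm_dist_laplacian /transmission_invsqrt_mx mul_mx_diag mul_diag_mx.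
rewrite !mxE /t /d; ring.
Qed.

Lemma norm_dist_laplacian_sym :
  (norm_dist_laplacian R e)^T = norm_dist_laplacian R e.
Proof.
apply/matrixP => i j; rewrite mxE !norm_dist_laplacianE /d.
rewrite (gdist_sym e_sym e_conn (enum_val j)).
by have [->|_] := eqVneq j i => //; rewrite !mulr0n; ring.
Qed.

Lemma sum_enum_val (F : V -> R) : \sum_(i < #|V|) F (enum_val i) = \sum_u F u.
Proof. by rewrite [RHS](reindex _ (onW_bij _ (enum_val_bij V))). Qed.

(** The change of variables f = T^(-1/2) x turns the Rayleigh quotient of the
    normalized Laplacian into that of T - D relative to T, and the condition
    that x be orthogonal to the diagonal of T^(-1/2) into \sum f = 0. *)
Lemma second_ndl_rayleigh : exists f : V -> R,
  [/\ exists u, f u != 0, \sum_u f u = 0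
    & (\sum_u t u * f u ^+ 2) - dist_form d f f
        <= ndl_eigenvalue R e 2 * \sum_u t u * f u ^+ 2].
Proof.
pose r u := (Num.sqrt (t u))^-1.
have r0 u : r u != 0 by rewrite invr_eq0 gt_eqF // sqrtr_gt0 transmission_gt0.
have tr u : t u * r u ^+ 2 = 1.
  by rewrite exprVn sqr_sqrtr ?divff ?gt_eqF ?ltW ?transmission_gt0.
have [x [[i0 xi0] x0 le_x]] := second_eigenvalue_rayleigh
  (fun i => r (enum_val i)) norm_dist_laplacian_sym V_ge2.
pose f u := x (enum_rank u) * r u.
have fE i : f (enum_val i) = x i * r (enum_val i) by rewrite /f enum_valK.
have sE : \sum_i x i ^+ 2 = \sum_u t u * f u ^+ 2.
  rewrite -sum_enum_val; apply: eq_bigr => i _.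
  by rewrite fE exprMn mulrCA tr mulr1.
exists f; split.
- by exists (enum_val i0); rewrite fE mulf_neq0.
- by rewrite -sum_enum_val -[RHS]x0; apply: eq_bigr => i _; rewrite fE.
rewrite -sE; apply: le_trans le_x; rewrite sE /dist_form.
rewrite -(@sum_enum_val (fun u => _ * _)) -(@sum_enum_val (fun u => \sum_v _)).
rewrite -sumrB.
rewrite le_eqVlt; apply/orP; left; apply/eqP; apply: eq_bigr => i _.
rewrite -sum_enum_val.
transitivity (\sum_j (x i * x j * r (enum_val i) * r (enum_val j)
      * (t (enum_val i) *+ (i == j)) - f (enum_val i) * f (enum_val j)
      * d (enum_val i) (enum_val j))); last first.
  apply: eq_bigr => j _; rewrite norm_dist_laplacianE !fE -/(r _) -/(r _).
  by ring.
rewrite sumrB; congr (_ - _); rewrite (bigD1 i) //= big1 => [|j ji].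
  by rewrite addr0 eqxx mulr1n fE; ring.
by rewrite eq_sym (negPf ji) mulr0.
Qed.

Let T : R := (max_transmission e)%:R.

Lemma le_max_transmission u : t u <= T.
Proof. by rewrite ler_nat; apply: (leq_bigmax_cond (F := transmission e)). Qed.

Lemma max_transmission_gt0 : 0 < T.
Proof.
have /card_gt1P[a _] := V_ge2.
exact: lt_le_trans (transmission_gt0 a) (le_max_transmission a).
Qed.

Let d_refl u : d u u = 0. Proof. by rewrite /d gdistxx. Qed.
Let d_sym u v : d u v = d v u. Proof. by rewrite /d (gdist_sym e_sym). Qed.
Let d_tri u v w : d u w <= d u v + d v w.
Proof. by rewrite /d -natrD ler_nat gdist_triangle. Qed.
Let d_ge1 u v : u != v -> 1 <= d u v.
Proof. by move=> uv; rewrite /d ler1n gdist_gt0. Qed.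

(** One test function serves both the bound and its equality case: equality in
    the bound leaves no room in any inequality of the chain for f. *)
Lemma ndl_gap_witness : exists f : V -> R,
  [/\ exists u, f u != 0, \sum_u f u = 0,
     2 / 3 + 4 / (3 * T) <= ndl_eigenvalue R e 2
   & ndl_eigenvalue R e 2 = 2 / 3 + 4 / (3 * T) ->
     3 * dist_form d f f + 4 * \sum_u f u ^+ 2
       = \sum_u (\sum_v d u v) * f u ^+ 2].
Proof.
have [f [fN0 f0 le_f]] := second_ndl_rayleigh.
have := dist_form_le d_refl d_sym d_tri d_ge1 f0.
have tE : \sum_u (\sum_v d u v) * f u ^+ 2 = \sum_u t u * f u ^+ 2.
  by apply: eq_bigr => u _; rewrite sum_gdistE.
have T0 := max_transmission_gt0.
rewrite tE; set S := \sum_u t u * f u ^+ 2 in le_f tE *; set Q := \sum_u f u ^+ 2.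
move=> le_form.
have S_gt0 : 0 < S.
  have [u fu] := fN0.
  rewrite /S (bigD1 u) //= ltr_wpDr ?sumr_ge0 // => [v _|].
    by rewrite mulr_ge0 ?sqr_ge0 // ltW // transmission_gt0.
  by rewrite mulr_gt0 ?transmission_gt0 // lt_neqAle sqr_ge0 eq_sym sqrf_eq0 fu.
have SQ : S / T <= Q.
  rewrite ler_pdivrMr // mulrC mulr_sumr; apply: ler_sum => u _.
  by rewrite ler_wpM2r ?sqr_ge0 ?le_max_transmission.
have bE : (2 / 3 + 4 / (3 * T)) * S = 2 / 3 * S + 4 / 3 * (S / T).
  by field; rewrite gt_eqF.
exists f; split => //.
  rewrite -(ler_pM2r S_gt0) bE; move: le_f le_form SQ.
  by move: (S / T) (_ * S) (dist_form d f f) => ? ? ?; lra.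
move=> Eq; move: le_f; rewrite Eq bE tE => le_f; apply/eqP.
rewrite -/Q eq_le le_form /=; move: le_f SQ.
by move: (S / T) (dist_form d f f) => ? ?; lra.
Qed.

(** As |f| is constant and \sum f = 0, the two sign classes of f are equally
    large; adjacency is distance 1, that is, a change of sign. *)
Lemma equidistant_bipartition (f : V -> R) :
  (exists u, f u != 0) -> \sum_u f u = 0 ->
  3 * dist_form d f f + 4 * \sum_u f u ^+ 2
    = \sum_u (\sum_v d u v) * f u ^+ 2 ->
  exists2 m : nat, (1 <= m)%N & graph_iso e (complete_bipartite m m).
Proof.
move=> fN0 f0 Ef.
have [nE cross within] := dist_form_eq d_refl d_sym d_tri d_ge1 f0 fN0 Ef.
have {fN0} [u0 fu0] := fN0.
have fN0 u : f u != 0 by rewrite -normr_eq0 (nE u u0) normr_eq0.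
have eE u v : e u v = (0 < f u) (+) (0 < f v).
  have e1 : e u v = (d u v == 1) by rewrite -(gdist_eq1 e_irr e_conn) /d pnatr_eq1.
  have d21 x y : d x y = 2 -> (d x y == 1) = false.
    by move=> ->; rewrite (eqr_nat R 2 1).
  have [<-|uv] := eqVneq u v; first by rewrite addbb e_irr.
  rewrite e1; have := fN0 u; have := fN0 v; rewrite !neq_lt => /orP[] fv /orP[] fu.
  - by rewrite d21 ?ltNge ?ltW //; apply: within => //; rewrite nmulr_rgt0.
  - by rewrite cross // eqxx fu ltNge ltW.
  - by rewrite d_sym cross // eqxx fv ltNge ltW.
  - by rewrite d21 ?fu ?fv //; apply: within => //; rewrite mulr_gt0.
pose P := [set u | 0 < f u].
have cardPC : #|~: P| = #|P|.
  have c_gt0 : 0 < `|f u0| by rewrite normr_gt0.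
  move: f0; rewrite (bigID (mem P)) /= => /eqP.
  rewrite [X in X + _](_ : _ = `|f u0| * #|P|%:R); last first.
    rewrite mulr_natr -sumr_const; apply: eq_bigr => u.
    by rewrite inE => fu; rewrite -(nE u) gtr0_norm.
  rewrite [X in _ + X](_ : _ = - `|f u0| * #|~: P|%:R); last first.
    rewrite mulr_natr -sumr_const; apply: eq_big => u; rewrite !inE // => fu.
    by rewrite -(nE u) ler0_norm ?opprK // leNgt.
  rewrite mulNr subr_eq0 => /eqP/(mulfI (lt0r_neq0 c_gt0))/eqP.
  by rewrite eqr_nat => /eqP.
pose m := #|P|.
have cardV : #|V| = (m + m)%N by rewrite -(cardsC P) cardPC.
exists m; first by have := V_ge2; rewrite cardV; case: (m).
pose h (w : 'I_m + 'I_m) : V := match w with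
  | inl i => enum_val i
  | inr j => enum_val (cast_ord (esym cardPC) j) end.
pose side (w : 'I_m + 'I_m) := if w is inl _ then true else false.
have hP w : (0 < f (h w)) = side w.
  case: w => i /=; first by have := enum_valP i; rewrite inE.
  by have := enum_valP (cast_ord (esym cardPC) i); rewrite !inE => /negPf.
have h_inj : injective h.
  move=> w w' hw; have : side w = side w' by rewrite -!hP hw.
  case: w w' hw => [i|i] [j|j] //= /enum_val_inj; first by move=> ->.
  by move/cast_ord_inj => ->.
have [g hK gK] : bijective h.
  by apply: inj_card_bij => //; rewrite cardV card_sum card_ord.
exists g; first by exists h.
move=> u v; rewrite -{2}[u]gK -{2}[v]gK eE !hP.
by case: (g u) (g v) => [?|?] [?|?].
Qed.

End DistanceLaplacian.

(** * The complete bipartite graphs with equal parts *)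

Section CompleteBipartite.
Variables (R : realType) (V : finType) (e : rel V).
Hypotheses (e_sym : symmetric e) (e_irr : irreflexive e).
Hypothesis e_conn : forall u v : V, connect e u v.
Variables (m : nat) (g : V -> 'I_m + 'I_m).
Hypothesis m_gt0 : (0 < m)%N.
Hypotheses (g_bij : bijective g)
  (g_iso : forall u v, complete_bipartite m m (g u) (g v) = e u v).

Let d (u v : V) : R := (gdist e u v)%:R.

Definition side_sign (u : V) : R := if g u is inl _ then 1 else -1.

Lemma sum_edges u : \sum_v (e u v)%:R = m%:R :> R.
Proof.
have [h gK hK] := g_bij.
rewrite (reindex h) /=; last by exists g => x _.
under eq_bigr => w _ do rewrite -g_iso hK.
rewrite big_sumType /=.
by case: (g u) => i /=; rewrite !sumr_const !card_ord mul0rn ?addr0 ?add0r.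
Qed.

Lemma bipartite_distE u v : d u v = 2 - 2 * (u == v)%:R - (e u v)%:R.
Proof.
have [h gK hK] := g_bij; rewrite /d.
have [<-|uv] := eqVneq u v; first by rewrite gdistxx e_irr /=; ring.
have [uv1|uv1] := boolP (e u v).
  by move: (uv1); rewrite -(gdist_eq1 e_irr e_conn) => /eqP -> /=; ring.
have le2 : (gdist e u v <= 2)%N.
  pose w : V := h (if g u is inl _ then inr (Ordinal m_gt0) else inl (Ordinal m_gt0)).
  have uw : e u w by rewrite -g_iso hK; case: (g u).
  have wv : e w v.
    by move: uv1; rewrite -!g_iso hK; case: (g u) (g v) => [?|?] [?|?].
  by apply: (@gdist_le_path _ e u [:: w; v]); rewrite /= uw wv.
have := gdist_gt0 e_conn uv; have := uv1; rewrite -(gdist_eq1 e_irr e_conn).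
by case: (gdist e u v) le2 => [|[|[|k]]] //= _ _ _; ring.
Qed.

Lemma bipartite_transmission u : (transmission e u)%:R = 3 * m%:R - 2 :> R.
Proof.
have cardV : \sum_(v : V) 2 = 4 * m%:R :> R.
  rewrite sumr_const; have -> : #|[pred v : V | true]| = (m + m)%N.
    by rewrite (bij_eq_card g_bij) card_sum card_ord.
  by ring.
rewrite /transmission natr_sum -/d.
under eq_bigr do rewrite -/(d _ _) bipartite_distE.
rewrite !sumrB cardV sum_edges (bigD1 u) //= big1 => [|v vu].
  by rewrite eqxx /=; ring.
by rewrite eq_sym (negPf vu) mulr0.
Qed.

Lemma side_sign_dist v :
  \sum_u side_sign u * d u v = side_sign v * (m%:R - 2).
Proof.
have signE u : side_sign u * d u v
    = side_sign v * (d u v - 2 * (e v u)%:R).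
  rewrite bipartite_distE -(e_sym u v) -g_iso /side_sign.
  have [<-|_] := eqVneq u v; first by case: (g u) => ? /=; ring.
  by case: (g u) (g v) => [?|?] [?|?] /=; ring.
under eq_bigr do rewrite signE.
rewrite -mulr_sumr sumrB -mulr_sumr sum_edges; congr (_ * _).
have -> : \sum_u d u v = \sum_u d v u.
  by apply: eq_bigr => u _; rewrite /d (gdist_sym e_sym e_conn).
by rewrite /d -natr_sum bipartite_transmission; ring.
Qed.

(** All transmissions equal 3 m - 2, so the normalized Laplacian is
    1 - D / (3 m - 2) and has the eigenvectors of D. *)
Lemma bipartite_eigenvalue (x : V -> R) (a : R) : (exists v, x v != 0) ->
  (forall v, \sum_u x u * d u v = a * x v) ->
  eigenvalue (norm_dist_laplacian R e) (1 - a / (3 * m%:R - 2)).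
Proof.
move=> [v0 xv0] xd; pose r := Num.sqrt (3 * m%:R - 2 : R).
have t_gt0 : 0 < 3 * m%:R - 2 :> R.
  by have : 1 <= m%:R :> R by [rewrite ler1n]; lra.
have r2 : r^-1 * r^-1 = (3 * m%:R - 2)^-1.
  by rewrite -invfM -expr2 sqr_sqrtr // ltW.
apply/eigenvalueP; exists (\row_i x (enum_val i)); last first.
  apply/eqP => /rowP/(_ (enum_rank v0)); rewrite !mxE enum_rankK => /eqP.
  by rewrite (negPf xv0).
apply/rowP => j; rewrite !mxE.
transitivity (\sum_(i < #|V|) ((x (enum_val i) *+ (i == j))
   - (3 * m%:R - 2)^-1 * (x (enum_val i) * d (enum_val i) (enum_val j)))).
  apply: eq_bigr => i _; rewrite norm_dist_laplacianE !mxE.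
  rewrite !bipartite_transmission -/r r2 -/(d _ _).
  by have [->|_] := eqVneq i j; rewrite ?mulr0n ?mulr1n; field; rewrite gt_eqF.
rewrite sumrB -mulr_sumr (sum_enum_val (fun u => x u * d u (enum_val j))) xd.
rewrite (bigD1 j) //= big1 => [|i ij]; last by rewrite (negPf ij).
by rewrite eqxx mulr1n addr0; field; rewrite gt_eqF.
Qed.

(** The two distinct eigenvalues 0 and 2 / 3 + 4 / (3 t_max) are at most
    the bound, so two entries of the sorted list are. *)
Lemma bipartite_gap_le :
  ndl_eigenvalue R e 2 <= 2 / 3 + 4 / (3 * (max_transmission e)%:R).
Proof.
have t_gt0 : 0 < 3 * m%:R - 2 :> R.
  by have : 1 <= m%:R :> R by [rewrite ler1n]; lra.
have [h gK hK] := g_bij; pose u0 : V := h (inl (Ordinal m_gt0)).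
have -> : (max_transmission e)%:R = 3 * m%:R - 2 :> R.
  rewrite -(bipartite_transmission u0); congr _%:R; apply/eqP.
  rewrite eqn_leq leq_bigmax andbT; apply/bigmax_leqP => u _.
  by rewrite -(ler_nat R) !bipartite_transmission.
have ev0 : eigenvalue (norm_dist_laplacian R e) 0.
  have := @bipartite_eigenvalue (fun=> 1) (3 * m%:R - 2).
  rewrite divff; last by rewrite gt_eqF.
  rewrite subrr; apply; first by exists u0; rewrite oner_eq0.
  move=> v; rewrite mulr1 -(bipartite_transmission v) natr_sum.
  by apply: eq_bigr => u _; rewrite mul1r /d (gdist_sym e_sym e_conn).
have ev1 : eigenvalue (norm_dist_laplacian R e)
    (2 / 3 + 4 / (3 * (3 * m%:R - 2))).
  have := @bipartite_eigenvalue side_sign (m%:R - 2).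
  rewrite (_ : 1 - _ = 2 / 3 + 4 / (3 * (3 * m%:R - 2))); last first.
    by field; rewrite gt_eqF.
  apply; first by exists u0; rewrite /side_sign hK /= oner_eq0.
  by move=> v; rewrite side_sign_dist mulrC.
set b := 2 / 3 + _ in ev1 *.
have b_gt0 : 0 < b.
  by rewrite /b addr_gt0 ?divr_gt0 ?mulr_gt0 ?ltr0n.
apply: nth1_le_of_count; first exact: sorted_eigenvalues.
rewrite -size_filter; apply: (@uniq_leq_size _ [:: 0; b]).
  by rewrite /= inE eq_sym gt_eqF.
move=> x; rewrite !inE mem_filter => /orP[] /eqP->.
  by rewrite /= (ltW b_gt0) mem_eigenvalues.
by rewrite /= lexx mem_eigenvalues.
Qed.

End CompleteBipartite.

Theorem theorem1p3 (R : realType) (V : finType) (e : rel V)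
    (e_sym : symmetric e) (e_irr : irreflexive e)
    (e_conn : forall u v : V, connect e u v)
    (V_ge2 : (2 <= #|V|)%N) :
  2 / 3 + 4 / (3 * (max_transmission e)%:R) <= ndl_eigenvalue R e 2
  /\ (ndl_eigenvalue R e 2 = 2 / 3 + 4 / (3 * (max_transmission e)%:R)
      <-> exists2 m : nat, (1 <= m)%N & graph_iso e (complete_bipartite m m)).
Proof.
have [f [fN0 f0 gap tight]] := ndl_gap_witness R e_sym e_conn V_ge2.
split=> //; split=> [/tight | [m m_gt0 [g g_bij g_iso]]].
  exact: (equidistant_bipartition (R := R) e_sym e_irr e_conn V_ge2).
apply/eqP; rewrite eq_le gap andbT.
exact: (bipartite_gap_le R e_sym e_irr e_conn m_gt0 g_bij g_iso).
Qed.
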